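(* Let $P=(\varphi_n)_{n=0}^\infty$ be any sequence with $\varphi_0\in\mathbb{N}$ a constant and $\varphi_n\colon\mathbb{N}^n\to\mathbb{N}$ a function for each $n\ge 1$. Then every $x\in(0,1)\setminus IS^{P^-}$ has a unique $P^-$-representation, i.e., there exists a unique sequence of natural numbers $(q_n)_{n=1}^\infty$ such that $$x=\sum_{n=0}^{\infty}\frac{(-1)^n r_0 r_1 \cdots r_n}{(q_1-1)q_1\cdots (q_n-1)q_n (q_{n+1}-1)},$$ where $r_0=\varphi_0$, $r_n=\varphi_n(q_1,\ldots,q_n)$, and $q_{n}\geq r_{n-1}+1$ for all $n\in\mathbb{N}$.
   Context: $\mathbb{N}=\{1,2,3,\dots\}$. The $n=0$ term of the series is understood to be $\frac{r_0}{q_1-1}$. If $x\in(0,1)$ is the sum of such a series with $r_0=\varphi_0$, $r_n=\varphi_n(q_1,\ldots,q_n)$ and natural numbers $q_n\ge r_{n-1}+1$ for all $n\in\mathbb{N}$, the series is called a $P^-$-representation of $x$, written $x=\Delta^{P^-}_{q_1q_2\ldots}$. For $k\ge1$ and $c_1,\dots,c_k\in\mathbb{N}$, let $\Delta^{P^-}_{c_1\ldots c_k}$ be the set of all $x\in(0,1)$ that have a $P^-$-representation with $q_1=c_1,\ldots,q_k=c_k$; when non-empty, this set is called a $P^-$-cylinder of rank $k$ with base $c_1\ldots c_k$. $IS^{P^-}$ denotes the set of all infima and suprema of all $P^-$-cylinders (of all ranks $k\ge 1$). *)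

(* Defs.v *)
From HB Require Import structures.
From mathcomp Require Import all_boot all_order all_algebra.
From mathcomp Require Import all_classical all_reals all_analysis.

Set Implicit Arguments.
Unset Strict Implicit.
Unset Printing Implicit Defensive.

Import Order.TTheory GRing.Theory Num.Theory.
Import numFieldNormedType.Exports.

Local Open Scope classical_set_scope.
Local Open Scope ring_scope.

(* The natural numbers here start at 1, so a sequence of functions
   phi_n : N^n -> N is encoded as a family on n-tuples of [nat] that sends
   tuples of positive numbers to positive numbers; the values on other tuples
   are never used. The constant phi_0 is [phi 0 [tuple]]. *)
Definition Pfamily (phi : forall n, n.-tuple nat -> nat) : Prop :=
  forall n (t : n.-tuple nat),
    (forall i, (0 < tnth t i)%N) -> (0 < phi n t)%N.

(* Sequences (q_n)_{n >= 1} are indexed from 0: [q i] stands for q_{i+1}.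
   Thus [Pr phi q n] is r_n = phi_n(q_1, ..., q_n). *)
Definition Pr (phi : forall n, n.-tuple nat -> nat) (q : nat -> nat)
    (n : nat) : nat :=
  phi n [tuple q i | i < n].

(* The denominator is (q_1 - 1) q_1 ... (q_n - 1) q_n (q_{n+1} - 1). *)
Definition Pterm (R : realType) (phi : forall n, n.-tuple nat -> nat)
    (q : nat -> nat) (n : nat) : R :=
  (-1) ^+ n * (\prod_(i < n.+1) (Pr phi q i)%:R) /
  ((\prod_(i < n) (((q i)%:R - 1) * (q i)%:R)) * ((q n)%:R - 1)).

(* [(Pr phi q n).+1 <= q n] is q_{n+1} >= r_n + 1. *)
Definition Prepresentation (R : realType)
    (phi : forall n, n.-tuple nat -> nat) (q : nat -> nat) (x : R) : Prop :=
  [/\ 0 < x < 1,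
      forall n, (0 < q n)%N,
      forall n, ((Pr phi q n).+1 <= q n)%N &
      series (@Pterm R phi q) @ \oo --> x].

Definition Pcylinder (R : realType) (phi : forall n, n.-tuple nat -> nat)
    (k : nat) (c : k.-tuple nat) : set R :=
  [set x | exists2 q : nat -> nat,
             Prepresentation phi q x & [tuple q i | i < k] = c].

Arguments Pcylinder R phi {k} c.

Definition PIS (R : realType) (phi : forall n, n.-tuple nat -> nat) : set R :=
  [set y | exists (k : nat) (c : k.-tuple nat),
     [/\ (0 < k)%N, Pcylinder R phi c !=set0 &
         y = inf (Pcylinder R phi c) \/ y = sup (Pcylinder R phi c)]].

Arguments PIS R phi : clear implicits.

(* Main.v *)
Require Import Defs.
From HB Require Import structures.
From mathcomp Require Import all_boot all_order all_algebra.
From mathcomp Require Import all_classical all_reals all_analysis.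
From mathcomp Require Import ring lra.

Set Implicit Arguments.
Unset Strict Implicit.
Unset Printing Implicit Defensive.

Import Order.TTheory GRing.Theory Num.Theory.
Import numFieldNormedType.Exports.

Local Open Scope classical_set_scope.
Local Open Scope ring_scope.

(** The expansion is a digit algorithm. Write S_n for the n-th partial sum, W_n
    for the product of the n factors r_{i-1} / ((q_i - 1) q_i), and t_n for the
    normalized remainder, x = S_n + (-1)^n W_n t_n, so that t_0 = x. Splitting
    off one term of the series gives
      t_n = r_n / (q_{n+1} - 1) - r_n / ((q_{n+1} - 1) q_{n+1}) * t_{n+1},
    an affine map carrying t_{n+1} in (0,1) onto the interval
    (r_n / q_{n+1}, r_n / (q_{n+1} - 1)) of values of t_n.

    The digit condition q_{n+1} >= r_n + 1 makes W_n at most 2^-n, and makes the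
    series alternating with terms that decrease to 0. Hence every sequence
    satisfying this condition represents a number, and all remainders of a
    representation lie in (0,1) ([Ptail_in01]). The displayed interval then
    forces q_{n+1} = floor (r_n / t_n) + 1, where t_n and r_n depend only on
    the earlier digits; so a representation is unique, whatever x is
    ([Prepresentation_greedy]).

    For existence, choose the digits by that formula. The condition
    q_{n+1} >= r_n + 1 holds because t_n < 1, and the new remainder t_{n+1}
    stays in [0,1) ([Pgreedy_tail]). If no remainder vanishes, the bound on W_n
    shows that the series converges to x. If t_{n+1} = 0, then x is the partial
    sum S_{n+1}. Consider the cylinder with base q_1 ... q_{n+1}: its points
    are S_{n+1} + (-1)^(n+1) W_{n+1} t with t in (0,1), all on the same side of
    x, and t becomes arbitrarily small when the next digit is large. So x is
    the infimum or the supremum of that cylinder ([partial_sum_in_PIS]), which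
    is excluded. *)

(** * Digit sequences and their prefixes *)

Definition agree_below (n : nat) (q q' : nat -> nat) : Prop :=
  forall i, (i < n)%N -> q i = q' i.

(** The digit condition is imposed on the first [k] digits only, because the
    digit algorithm and the cylinders handle finite prefixes. *)
Definition Padmissible (phi : forall n, n.-tuple nat -> nat)
    (q : nat -> nat) (k : nat) : Prop :=
  forall i, (i < k)%N -> (Pr phi q i < q i)%N.

(** The scale W_n of the n-th remainder: the n-th term of the series is
    (-1)^n W_n r_n / (q_{n+1} - 1). *)
Definition Pweight (R : realType) (phi : forall n, n.-tuple nat -> nat)
    (q : nat -> nat) (n : nat) : R :=
  \prod_(i < n) ((Pr phi q i)%:R / (((q i)%:R - 1) * (q i)%:R)).

(** The normalized remainder t_n. When the series sums to [x], it is the sum of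
    the series of the same shape that starts with r_n and the digits q_{n+1},
    q_{n+2}, etc. Defining it from [x] and a partial sum makes sense before any
    convergence is known, and involves the first n digits only. *)
Definition Ptail (R : realType) (phi : forall n, n.-tuple nat -> nat)
    (q : nat -> nat) (x : R) (n : nat) : R :=
  (-1) ^+ n * (x - series (Pterm R phi q) n) / Pweight R phi q n.

(** Course-of-values recursion in a form that fits functions of finite tuples:
    the rule [step n] receives a whole sequence but may look only at its first
    [n] entries. *)
Lemma prefix_recursion (step : nat -> (nat -> nat) -> nat) :
  (forall n q q', agree_below n q q' -> step n q = step n q') ->
  exists q : nat -> nat, forall n, q n = step n q.
Proof.
move=> step_ext.
(* L n lists the first n values; missing entries are read as the default 0. *)
pose L := fix L n := if n is m.+1 then rcons (L m) (step m (nth 0%N (L m)))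
                     else [::].
have sL n : size (L n) = n by elim: n => //= n IH; rewrite size_rcons IH.
pose q n := nth 0%N (L n.+1) n.
have qE n : q n = step n (nth 0%N (L n)).
  by rewrite /q /= nth_rcons sL ltnn eqxx.
have Lq n : agree_below n (nth 0%N (L n)) q.
  elim: n => [|n IH] i //; rewrite ltnS leq_eqVlt => /predU1P[->//|ltin] /=.
  by rewrite nth_rcons sL ltin IH.
by exists q => n; rewrite qE; exact: step_ext.
Qed.

(** The [_ext] lemmas record which data depend on the first n digits only. This
    lets the digit algorithm be a recursion and makes the points of a cylinder
    share partial sums and scales. *)
Lemma Pr_ext (phi : forall n, n.-tuple nat -> nat) q q' n :
  agree_below n q q' -> Pr phi q n = Pr phi q' n.
Proof.
move=> qq'; rewrite /Pr; congr (phi n _).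
by apply: eq_from_tnth => i; rewrite !tnth_mktuple qq'.
Qed.

Lemma agree_belowW m n q q' :
  (m <= n)%N -> agree_below n q q' -> agree_below m q q'.
Proof. by move=> mn qq' i im; apply: qq'; exact: leq_trans im mn. Qed.

Lemma Padmissible_ext (phi : forall n, n.-tuple nat -> nat) q q' n :
  agree_below n q q' -> Padmissible phi q n -> Padmissible phi q' n.
Proof.
move=> qq' adm i ltin; rewrite -qq' // -(@Pr_ext _ q) ?adm //.
exact: agree_belowW (ltnW ltin) qq'.
Qed.

Lemma Pweight_ext (R : realType) (phi : forall n, n.-tuple nat -> nat) q q' n :
  agree_below n q q' -> Pweight R phi q n = Pweight R phi q' n.
Proof.
move=> qq'; apply: eq_bigr => i _; rewrite qq' //.
by rewrite (@Pr_ext _ q q') //; apply: agree_belowW qq'; exact: ltnW.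
Qed.

(** * Partial sums and remainders *)

Lemma PtermE (R : realType) (phi : forall n, n.-tuple nat -> nat) q n :
  Pterm R phi q n =
  (-1) ^+ n * Pweight R phi q n * ((Pr phi q n)%:R / ((q n)%:R - 1)).
Proof.
rewrite /Pterm /Pweight big_ord_recr /= prodf_div invfM.
by rewrite -!mulrA; congr (_ * (_ * _)); rewrite mulrCA.
Qed.

Lemma partial_sum_ext (R : realType) (phi : forall n, n.-tuple nat -> nat)
    q q' n :
  agree_below n q q' ->
  series (Pterm R phi q) n = series (Pterm R phi q') n.
Proof.
move=> qq'; apply: eq_big_nat => k /= kn.
have qq'k := agree_belowW (ltnW kn) qq'.
by rewrite !PtermE (Pweight_ext _ _ qq'k) (Pr_ext _ qq'k) qq'.
Qed.

Lemma Ptail_ext (R : realType) (phi : forall n, n.-tuple nat -> nat)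
    q q' (x : R) n :
  agree_below n q q' -> Ptail phi q x n = Ptail phi q' x n.
Proof.
by move=> qq'; rewrite /Ptail (partial_sum_ext _ _ qq') (Pweight_ext _ _ qq').
Qed.

Lemma PadmissibleW (phi : forall n, n.-tuple nat -> nat) q m n :
  (m <= n)%N -> Padmissible phi q n -> Padmissible phi q m.
Proof. by move=> mn adm i im; apply: adm; exact: leq_trans im mn. Qed.

Lemma Pr_gt0 (phi : forall n, n.-tuple nat -> nat) q n :
  Pfamily phi -> Padmissible phi q n -> (0 < Pr phi q n)%N.
Proof.
move=> hphi adm; apply: hphi => i; rewrite tnth_mktuple.
exact: leq_ltn_trans (adm i _).
Qed.

Lemma Pdigit_bounds (R : realType) (phi : forall n, n.-tuple nat -> nat) q n :
  Pfamily phi -> Padmissible phi q n.+1 ->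
  1 <= (Pr phi q n)%:R :> R /\ (Pr phi q n)%:R + 1 <= (q n)%:R :> R.
Proof.
move=> hphi adm; split; last by rewrite natr1 ler_nat adm.
by rewrite ler1n Pr_gt0 //; exact: PadmissibleW adm.
Qed.

Lemma PweightS (R : realType) (phi : forall n, n.-tuple nat -> nat) q n :
  Pweight R phi q n.+1 =
  Pweight R phi q n * ((Pr phi q n)%:R / (((q n)%:R - 1) * (q n)%:R)).
Proof. exact: big_ord_recr. Qed.

(** Each factor r / ((q - 1) q) is at most 1 / q, since r <= q - 1, and q >= 2
    because r >= 1. *)
Lemma Pweight_bounds (R : realType) (phi : forall n, n.-tuple nat -> nat) q n :
  Pfamily phi -> Padmissible phi q n ->
  0 < Pweight R phi q n <= 2^-1 ^+ n.
Proof.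
move=> hphi; elim: n => [|n IH] adm.
  by rewrite /Pweight big_ord0 expr0 ltr01 lexx.
have [r1 rq] := Pdigit_bounds R hphi adm.
have /andP[W0 Wn] := IH (PadmissibleW (leqnSn n) adm).
set r := _%:R in r1 rq; set d := _%:R in rq.
rewrite PweightS exprSr -/r -/d; apply/andP; split.
  by rewrite mulr_gt0 // divr_gt0 ?mulr_gt0; lra.
rewrite ler_pM ?(ltW W0) // ?divr_ge0 ?mulr_ge0; try lra.
by rewrite ler_pdivrMr ?mulr_gt0; nra.
Qed.

Lemma Pweight_gt0 (R : realType) (phi : forall n, n.-tuple nat -> nat) q n :
  Pfamily phi -> Padmissible phi q n -> 0 < Pweight R phi q n.
Proof. by move=> hphi adm; have /andP[] := Pweight_bounds R hphi adm. Qed.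

Lemma PtailE (R : realType) (phi : forall n, n.-tuple nat -> nat) q (x : R) n :
  Pfamily phi -> Padmissible phi q n ->
  x = series (Pterm R phi q) n +
      (-1) ^+ n * (Pweight R phi q n * Ptail phi q x n).
Proof.
move=> hphi adm; have W0 := Pweight_gt0 R hphi adm.
rewrite /Ptail [Pweight _ _ _ _ * _]mulrC divfK ?gt_eqF//.
by rewrite mulrA -expr2 sqrr_sign mul1r addrC subrK.
Qed.

(** The step of the digit algorithm: removing the term of index n from the
    remainder. *)
Lemma Ptail_rec (R : realType) (phi : forall n, n.-tuple nat -> nat) q (x : R)
    n :
  Pfamily phi -> Padmissible phi q n.+1 ->
  Ptail phi q x n = (Pr phi q n)%:R / ((q n)%:R - 1) -
    (Pr phi q n)%:R / (((q n)%:R - 1) * (q n)%:R) * Ptail phi q x n.+1.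
Proof.
move=> hphi adm.
have W0 := Pweight_gt0 R hphi (PadmissibleW (leqnSn n) adm).
have [r1 rq] := Pdigit_bounds R hphi adm.
rewrite /Ptail seriesSr PweightS PtermE exprS.
(* The sign is generalized to some s with s * s = 1, which has to be applied by
   hand since the ring normalization cannot use it. *)
have s2 : (-1 : R) ^+ n * (-1) ^+ n = 1 by rewrite -expr2 sqrr_sign.
set r := _%:R in r1 rq *; set d := _%:R in rq *.
set s := (-1) ^+ n in s2 *; set W := Pweight _ _ _ _ in W0 *.
have -> : -1 * s * (x - (series (Pterm R phi q) n + s * W * (r / (d - 1)))) =
  - (s * (x - series (Pterm R phi q) n)) + W * (r / (d - 1)).
  by transitivity (- (s * (x - series (Pterm R phi q) n)) +
       (s * s) * (W * (r / (d - 1)))); [ring | rewrite s2 mul1r].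
field; do ![apply/andP; split]; lra.
Qed.

(** The Leibniz argument for alternating series. The block of k + 1 terms
    starting at n equals its first term minus a block of k terms starting at
    n + 1, which lies between 0 and W_{n+1}, and W_{n+1} does not exceed the
    first term. *)
Lemma Pblock_bound (R : realType) (phi : forall n, n.-tuple nat -> nat) q n k :
  Pfamily phi -> (forall m, Padmissible phi q m) ->
  0 <= (-1) ^+ n * (series (Pterm R phi q) (n + k)%N - series (Pterm R phi q) n)
    <= Pweight R phi q n.
Proof.
move=> hphi adm; elim: k n => [|k IH] n.
  by rewrite addn0 subrr mulr0 lexx ltW // Pweight_gt0.
have W0 := Pweight_gt0 R hphi (adm n).
have [r1 rq] := Pdigit_bounds R hphi (adm n.+1).
have /andP[] := IH n.+1; rewrite addSnnS seriesSr PtermE PweightS exprS.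
have s2 : (-1 : R) ^+ n * (-1) ^+ n = 1 by rewrite -expr2 sqrr_sign.
set r := _%:R in r1 rq *; set d := _%:R in rq *.
set s := (-1) ^+ n in s2 *; set W := Pweight _ _ _ _ in W0 *.
set Sn := series _ n; set S' := series _ _.
have -> : -1 * s * (S' - (Sn + s * W * (r / (d - 1)))) =
    W * (r / (d - 1)) - s * (S' - Sn).
  by transitivity ((s * s) * (W * (r / (d - 1))) - s * (S' - Sn));
     [ring | rewrite s2 mul1r].
have d0 : d != 0 by rewrite gt_eqF //; lra.
have d1 : d - 1 != 0 by rewrite gt_eqF //; lra.
have -> : r / ((d - 1) * d) = (r / (d - 1)) / d by rewrite invfM mulrA.
have u0 : 0 <= r / (d - 1) by rewrite divr_ge0 //; lra.
have u1 : r / (d - 1) <= 1 by rewrite ler_pdivrMr; lra.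
have v1 : r / (d - 1) / d <= r / (d - 1).
  by rewrite ler_pdivrMr; [nra | lra].
move: (r / (d - 1)) (r / (d - 1) / d) u0 u1 v1 => u v u0 u1 v1 h1 h2.
by apply/andP; split; nra.
Qed.

(** The terms are bounded by W_n, hence by 2^-n. *)
Lemma cvg_partial_sums (R : realType) (phi : forall n, n.-tuple nat -> nat) q :
  Pfamily phi -> (forall m, Padmissible phi q m) ->
  cvgn (series (Pterm R phi q)).
Proof.
move=> hphi adm; apply: normed_cvg.
apply: (@series_le_cvg _ _ (geometric 1 2^-1)) => [n|n|n|] /=.
- exact: normr_ge0.
- by rewrite mul1r exprn_ge0 // invr_ge0.
- have /andP[W0 Wn] := Pweight_bounds R hphi (adm n).
  have [r1 rq] := Pdigit_bounds R hphi (adm n.+1).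
  rewrite PtermE mul1r -mulrA normrM normr_sign mul1r; apply: le_trans Wn.
  set r := _%:R in r1 rq *; set d := _%:R in rq *.
  have u0 : 0 <= r / (d - 1) by rewrite divr_ge0 //; lra.
  have u1 : r / (d - 1) <= 1 by rewrite ler_pdivrMr; lra.
  by rewrite ger0_norm ?mulr_ge0 ?(ltW W0) //; nra.
- by apply: is_cvg_geometric_series; rewrite ger0_norm ?invr_ge0 //; lra.
Qed.

(** Letting the length of the blocks in [Pblock_bound] tend to infinity. *)
Lemma Ptail_bounds_wide (R : realType) (phi : forall n, n.-tuple nat -> nat)
    q (x : R) n :
  Pfamily phi -> (forall m, Padmissible phi q m) ->
  series (Pterm R phi q) @ \oo --> x -> 0 <= Ptail phi q x n <= 1.
Proof.
move=> hphi adm Sx; have W0 := Pweight_gt0 R hphi (adm n).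
rewrite /Ptail ler_pdivlMr // mul0r ler_pdivrMr // mul1r.
have Sx' : (-1) ^+ n * (series (Pterm R phi q) k - series (Pterm R phi q) n)
    @[k --> \oo] --> (-1) ^+ n * (x - series (Pterm R phi q) n).
  by apply: cvgMr; apply: cvgB => //; exact: cvg_cst.
have bnd k : (n <= k)%N -> 0 <= (-1) ^+ n *
    (series (Pterm R phi q) k - series (Pterm R phi q) n) <= Pweight R phi q n.
  by move=> /subnKC <-; exact: Pblock_bound.
apply/andP; split.
- by apply: (cvgr_to_ge Sx'); exists n => // k /= /bnd /andP[].
- by apply: (cvgr_to_le Sx'); exists n => // k /= /bnd /andP[].
Qed.

(** Passing to the limit only gives weak inequalities. Strict ones follow by
    using the recursion twice: t_{m+1} <= 1 gives t_m >= r / q > 0 for every m,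
    and then t_{m+1} > 0 gives t_m < r / (q - 1) <= 1 for every m. *)
Lemma Ptail_digit_bounds (R : realType)
    (phi : forall n, n.-tuple nat -> nat) q (x : R) n :
  Pfamily phi -> (forall m, Padmissible phi q m) ->
  series (Pterm R phi q) @ \oo --> x ->
  (Pr phi q n)%:R / (q n)%:R < Ptail phi q x n
    < (Pr phi q n)%:R / ((q n)%:R - 1).
Proof.
move=> hphi adm Sx.
have wide m : 0 <= Ptail phi q x m <= 1 by exact: Ptail_bounds_wide.
have lowE (r d : R) : 1 <= r -> r + 1 <= d ->
  r / d = r / (d - 1) - r / ((d - 1) * d).
  by move=> r1 rq; field; apply/andP; split; lra.
have pos m : 0 < Ptail phi q x m.
  have [r1 rq] := Pdigit_bounds R hphi (adm m.+1).
  have := lowE _ _ r1 rq; rewrite (Ptail_rec _ hphi (adm m.+1)).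
  set r := _%:R in r1 rq *; set d := _%:R in rq *.
  have : 0 < r / d by rewrite divr_gt0; lra.
  have : 0 < r / ((d - 1) * d) by rewrite divr_gt0 ?mulr_gt0; lra.
  by have /andP[] := wide m.+1; nra.
have lt1 m : Ptail phi q x m < 1.
  have [r1 rq] := Pdigit_bounds R hphi (adm m.+1).
  rewrite (Ptail_rec _ hphi (adm m.+1)).
  set r := _%:R in r1 rq *; set d := _%:R in rq *.
  have : r / (d - 1) <= 1 by rewrite ler_pdivrMr; lra.
  have : 0 < r / ((d - 1) * d) by rewrite divr_gt0 ?mulr_gt0; lra.
  by have := pos m.+1; nra.
have [r1 rq] := Pdigit_bounds R hphi (adm n.+1).
rewrite (lowE _ _ r1 rq) (Ptail_rec _ hphi (adm n.+1)).
set r := _%:R in r1 rq *; set d := _%:R in rq *.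
have : 0 < r / ((d - 1) * d) by rewrite divr_gt0 ?mulr_gt0; lra.
have := pos n.+1; have := lt1 n.+1.
by move=> h1 h2 h3; apply/andP; split; nra.
Qed.

Lemma Ptail_in01 (R : realType)
    (phi : forall n, n.-tuple nat -> nat) q (x : R) n :
  Pfamily phi -> (forall m, Padmissible phi q m) ->
  series (Pterm R phi q) @ \oo --> x -> 0 < Ptail phi q x n < 1.
Proof.
move=> hphi adm Sx; have /andP[lo hi] := Ptail_digit_bounds n hphi adm Sx.
have [r1 rq] := Pdigit_bounds R hphi (adm n.+1).
apply/andP; split; [apply: le_lt_trans lo | apply: lt_le_trans hi _].
- by rewrite divr_ge0.
- by rewrite ler_pdivrMr; lra.
Qed.

Lemma Ptail0 (R : realType) (phi : forall n, n.-tuple nat -> nat) q (x : R) :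
  Ptail phi q x 0 = x.
Proof.
rewrite /Ptail /series /= big_geq // /Pweight big_ord0.
by rewrite expr0 mul1r divr1 subr0.
Qed.

(** The digit condition alone forces the sum into (0,1) and the digits to be
    positive. *)
Lemma PrepresentationP (R : realType) (phi : forall n, n.-tuple nat -> nat)
    q (x : R) : Pfamily phi ->
  Prepresentation phi q x <->
  (forall m, Padmissible phi q m) /\ series (Pterm R phi q) @ \oo --> x.
Proof.
move=> hphi; split=> [[_ _ adm Sx]|[adm Sx]].
  by split=> // m i _; exact: adm.
split=> // [|n|n].
- by rewrite -(Ptail0 phi q x); exact: Ptail_in01.
- by apply: leq_ltn_trans (adm n.+1 n _).
- exact: (adm n.+1 n).
Qed.

(** Bounded remainders are multiplied by W_n, which tends to 0. *)
Lemma cvg_of_Ptail_in01 (R : realType) (phi : forall n, n.-tuple nat -> nat)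
    q (x : R) : Pfamily phi -> (forall m, Padmissible phi q m) ->
  (forall n, 0 <= Ptail phi q x n <= 1) ->
  series (Pterm R phi q) @ \oo --> x.
Proof.
move=> hphi adm tail01.
have half1 : `|2^-1 : R| < 1 by rewrite ger0_norm ?invr_ge0 //; lra.
apply: (@squeeze_cvgr _ _ _ _ (fun n => x - geometric 1 2^-1 n)
  (fun n => x + geometric 1 2^-1 n)).
- apply: nearW => n /=.
  have /andP[W0 Wn] := Pweight_bounds R hphi (adm n).
  have /andP[t0 t1] := tail01 n.
  have := PtailE x hphi (adm n); rewrite mul1r.
  have wt0 : 0 <= Pweight R phi q n * Ptail phi q x n.
    by rewrite mulr_ge0 // ltW.
  have wt1 : Pweight R phi q n * Ptail phi q x n <= 2^-1 ^+ n by nra.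
  rewrite -signr_odd; case: (odd n); rewrite ?expr0 ?expr1 => ->;
    apply/andP; split; lra.
- rewrite -[X in _ --> X]subr0.
  by apply: cvgB; [exact: cvg_cst | exact: cvg_geometric].
- rewrite -[X in _ --> X]addr0.
  by apply: cvgD; [exact: cvg_cst | exact: cvg_geometric].
Qed.

(** * The digit algorithm *)

(** The only q with r / q < t < r / (q - 1), that is q - 1 < r / t < q, when
    r / t is not an integer. For integral r / t this choice makes t the right
    end of the interval, which is the value whose next remainder is 0. *)
Definition Pgreedy (R : realType) (phi : forall n, n.-tuple nat -> nat)
    (x : R) (n : nat) (q : nat -> nat) : nat :=
  (Num.truncn ((Pr phi q n)%:R / Ptail phi q x n)).+1.

Lemma Pgreedy_ext (R : realType) (phi : forall n, n.-tuple nat -> nat) (x : R)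
    n q q' :
  agree_below n q q' -> Pgreedy phi x n q = Pgreedy phi x n q'.
Proof.
by move=> qq'; rewrite /Pgreedy (Pr_ext _ qq') (Ptail_ext _ _ qq').
Qed.

Lemma Prepresentation_greedy (R : realType)
    (phi : forall n, n.-tuple nat -> nat) q (x : R) n :
  Pfamily phi -> Prepresentation phi q x -> q n = Pgreedy phi x n q.
Proof.
move=> hphi /(PrepresentationP _ _ hphi)[adm Sx].
have /andP[lo hi] := Ptail_digit_bounds n hphi adm Sx.
have /andP[t0 _] := Ptail_in01 n hphi adm Sx.
have [r1 rq] := Pdigit_bounds R hphi (adm n.+1).
have q0 : (0 < q n)%N by apply: leq_ltn_trans (adm n.+1 n _).
rewrite /Pgreedy -[LHS]prednK //; congr _.+1; apply/esym/truncn_def.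
have -> : (q n).-1%:R = (q n)%:R - 1 :> R by rewrite -subn1 natrB.
rewrite prednK //; move: lo hi rq.
set r := _%:R in r1 *; set d := _%:R => lo hi rq.
rewrite ler_pdivlMr // ltr_pdivrMr // [_ * Ptail _ _ _ _]mulrC.
rewrite -ler_pdivlMr; last lra.
by rewrite (ltW hi) /= mulrC -ltr_pdivrMr //; lra.
Qed.

(** The formula q_{n+1} = floor (r_n / t_n) + 1 places t_n in the half-open
    interval (r_n / q_{n+1}, r_n / (q_{n+1} - 1)], the image of [0,1) under the
    map of [Ptail_rec]. *)
Lemma Pgreedy_tail (R : realType) (phi : forall n, n.-tuple nat -> nat)
    q (x : R) n : Pfamily phi ->
  Padmissible phi q n -> 0 < Ptail phi q x n < 1 -> q n = Pgreedy phi x n q ->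
  Padmissible phi q n.+1 /\ 0 <= Ptail phi q x n.+1 < 1.
Proof.
move=> hphi adm /andP[t0 t1] qE.
have r0 : (0 < Pr phi q n)%N := Pr_gt0 hphi adm.
have rR0 : 0 < (Pr phi q n)%:R :> R by rewrite ltr0n.
have rt0 : 0 <= (Pr phi q n)%:R / Ptail phi q x n by rewrite divr_ge0 // ltW.
have adm1 : Padmissible phi q n.+1.
  move=> i; rewrite ltnS leq_eqVlt => /predU1P[->|]; last exact: adm.
  rewrite qE /Pgreedy ltnS truncn_ge_nat // ler_pdivlMr //; nra.
split=> //.
have [r1 rq] := Pdigit_bounds R hphi adm1.
have := truncn_itv rt0.
have -> : Num.truncn ((Pr phi q n)%:R / Ptail phi q x n) = (q n).-1.
  by rewrite qE.
have q0 : (0 < q n)%N by rewrite qE.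
have -> : (q n).-1%:R = (q n)%:R - 1 :> R by rewrite -subn1 natrB.
rewrite prednK // ler_pdivlMr // ltr_pdivrMr //.
rewrite (Ptail_rec x hphi adm1) in t0 t1 *.
move: r1 rq; clear.
move: (Pr phi q n)%:R (q n)%:R (Ptail phi q x n.+1) => r d t r1 rq.
case/andP.
have -> : (d - 1) * (r / (d - 1) - r / ((d - 1) * d) * t) = r - r / d * t.
  by field; apply/andP; split; lra.
have -> : d * (r / (d - 1) - r / ((d - 1) * d) * t) = r + r / (d - 1) * (1 - t).
  by field; apply/andP; split; lra.
have rd : 0 < r / d by rewrite divr_gt0; lra.
have rd1 : 0 < r / (d - 1) by rewrite divr_gt0; lra.
by move=> h1 h2; apply/andP; split; nra.
Qed.

(** * Ends of cylinders *)

(** Filling up with the least digits allowed, except that all of them are kept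
    at least [N]; what matters is that the first new digit can be made
    arbitrarily large. *)
Lemma Padmissible_extend (phi : forall n, n.-tuple nat -> nat) q k N :
  Padmissible phi q k ->
  exists q', [/\ agree_below k q q', forall m, Padmissible phi q' m &
                 (N <= q' k)%N].
Proof.
move=> adm.
pose step n q' := if (n < k)%N then q n else maxn N (Pr phi q' n).+1.
have [|q' q'E] := @prefix_recursion step.
  by move=> n p p' pp'; rewrite /step (Pr_ext _ pp').
have qq' : agree_below k q q' by move=> i ik; rewrite q'E /step ik.
exists q'; split=> // [m i _|].
  have [ik|ki] := ltnP i k; first exact: Padmissible_ext qq' adm i ik.
  by rewrite [X in (_ < X)%N]q'E /step (ltnNge i k) ki /= leq_max leqnn orbT.
by rewrite q'E /step ltnn leq_maxl.
Qed.

Lemma sup_adjacent (R : realType) (A : set R) (x : R) :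
  ubound A x -> (forall e, 0 < e -> exists2 y, A y & x - e < y) -> x = sup A.
Proof.
move=> Ax near_x; apply/eqP; rewrite eq_le; apply/andP; split.
- apply/ler_addgt0Pr => e e0; have [y Ay xy] := near_x e e0.
  by rewrite -lerBlDr (le_trans (ltW xy)) // ub_le_sup //; exists x.
- by apply: ge_sup => //; have [y Ay _] := near_x 1 ltr01; exists y.
Qed.

Lemma inf_adjacent (R : realType) (A : set R) (x : R) :
  lbound A x -> (forall e, 0 < e -> exists2 y, A y & y < x + e) -> x = inf A.
Proof.
move=> Ax near_x; apply/eqP; rewrite eq_le; apply/andP; split.
- by apply: lb_le_inf => //; have [y Ay _] := near_x 1 ltr01; exists y.
- apply/ler_addgt0Pr => e e0; have [y Ay xy] := near_x e e0.
  by rewrite (le_trans _ (ltW xy)) // ge_inf //; exists x.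
Qed.

(** The partial sum S_k is approached, from one side only, by the points of the
    cylinder of its own digits: such a point is at distance W_k t_k from S_k,
    and t_k < r_k / (q_{k+1} - 1) is small when q_{k+1} is large. The parity of
    k decides the side, hence whether S_k is the supremum or the infimum. *)
Lemma partial_sum_in_PIS (R : realType) (phi : forall n, n.-tuple nat -> nat)
    q k :
  Pfamily phi -> (0 < k)%N -> Padmissible phi q k ->
  PIS R phi (series (Pterm R phi q) k).
Proof.
move=> hphi k0 adm; set x := series _ _.
pose c := [tuple q i | i < k].
have cyl y : Pcylinder R phi c y ->
    exists2 u, 0 < u & y = x + (-1) ^+ k * u.
  move=> [q' /(PrepresentationP _ _ hphi)[adm' Sy] cE].
  have q'q : agree_below k q' q.
    move=> i ik; have := congr1 (fun t => tnth t (Ordinal ik)) cE.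
    by rewrite !tnth_mktuple.
  exists (Pweight R phi q' k * Ptail phi q' y k).
    rewrite mulr_gt0 ?Pweight_gt0 //.
    by have /andP[] := Ptail_in01 k hphi adm' Sy.
  by rewrite /x -(partial_sum_ext _ _ q'q); exact: PtailE.
have close e : 0 < e -> exists u, [/\ 0 < u, u < e &
    Pcylinder R phi c (x + (-1) ^+ k * u)].
  move=> e0.
  (* This digit q_{k+1} satisfies q_{k+1} - 1 > r_k / e. *)
  have [q' [qq' adm' Nq']] := Padmissible_extend
    (Num.truncn ((Pr phi q k)%:R / e)).+2 adm.
  have [y Sy] : exists y : R, series (Pterm R phi q') @ \oo --> y.
    by exists (limn (series (Pterm R phi q'))); exact: cvg_partial_sums.
  have /andP[_ hi] := Ptail_digit_bounds k hphi adm' Sy.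
  have /andP[t0 _] := Ptail_in01 k hphi adm' Sy.
  have /andP[W0 W1] := Pweight_bounds R hphi (adm' k).
  have {W1} W1 : Pweight R phi q' k <= 1.
    by apply: le_trans W1 _; rewrite exprn_ile1 ?invr_ge0 //; lra.
  have [r1 rq] := Pdigit_bounds R hphi (adm' k.+1).
  exists (Pweight R phi q' k * Ptail phi q' y k); split.
  - exact: mulr_gt0.
  - have te : Ptail phi q' y k < e.
      apply: lt_le_trans hi _; rewrite ler_pdivrMr; last lra.
      rewrite mulrC -ler_pdivrMr // -(Pr_ext _ qq').
      have := truncnS_gt ((Pr phi q k)%:R / e); move: Nq'.
      rewrite -(ler_nat R) -natr1; lra.
    by nra.
  - exists q'; last by apply: eq_from_tnth => i; rewrite !tnth_mktuple qq'.
    apply/(PrepresentationP _ _ hphi); split=> //.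
    by rewrite /x (partial_sum_ext _ _ qq') -PtailE.
exists k, c; split=> //.
  by have [u [_ _ cu]] := close 1 ltr01; exists (x + (-1) ^+ k * u).
move: cyl close; rewrite -signr_odd; case: (odd k) => cyl close.
- right; apply: sup_adjacent => [y /cyl[u u0 ->]|e /close[u [u0 ue cu]]].
    by rewrite expr1; lra.
  by eexists; [exact: cu | rewrite expr1; lra].
- left; apply: inf_adjacent => [y /cyl[u u0 ->]|e /close[u [u0 ue cu]]].
    by rewrite expr0; lra.
  by eexists; [exact: cu | rewrite expr0; lra].
Qed.

(** * The representation theorem *)

Theorem theorem3p13 (R : realType) (phi : forall n, n.-tuple nat -> nat)
    (hphi : Pfamily phi) (x : R) (hx : 0 < x < 1) (hIS : ~ PIS R phi x) :
  exists! q : nat -> nat, Prepresentation phi q x.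
Proof.
have [|q qE] := @prefix_recursion (Pgreedy phi x).
  by move=> n q q'; exact: Pgreedy_ext.
have tails n : Padmissible phi q n /\ 0 < Ptail phi q x n < 1.
  elim: n => [|n [adm t01]]; first by rewrite Ptail0.
  have [adm1 /andP[t0 t1]] := Pgreedy_tail hphi adm t01 (qE n).
  split=> //; rewrite t1 lt_neqAle t0 andbT andbT.
  (* A vanishing remainder would make x a partial sum, an end of a cylinder. *)
  apply/eqP => tail0; apply: hIS; rewrite (PtailE x hphi adm1) -tail0.
  by rewrite !mulr0 addr0; exact: partial_sum_in_PIS.
have adm n := (tails n).1.
exists q; split.
  apply/(PrepresentationP _ _ hphi); split=> //.
  apply: cvg_of_Ptail_in01 => // n.
  by have /andP[/ltW-> /ltW->] := (tails n).2.
move=> q' q'x; apply/funext => n.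
elim/ltn_ind: n => n IH; rewrite qE (Prepresentation_greedy n hphi q'x).
exact: Pgreedy_ext.
Qed.
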